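(* Let $\Delta$ and $\Lambda$ be countable distance value sets. Then $\mathrm{Aut}(\mathbb{U}^<_\Delta)$ and $\mathrm{Aut}(\mathbb{U}^<_\Lambda)$ are isomorphic as topological groups if and only if $\Delta$ and $\Lambda$ are equivalent.
   Context: A distance value set is a set $\Delta$ of positive real numbers such that for all $x,y\in\Delta$, $\min\{x+y,\sup\Delta\}\in\Delta$. A $\Delta$-metric space is a metric space whose nonzero distances all lie in $\Delta$. For countable $\Delta$, the class of finite linearly ordered $\Delta$-metric spaces (structures with binary relations $R_s$, $s\in\Delta$, encoding distance $s$, and a linear order $<$) is a Fraïssé class; $\mathbb{U}^<_\Delta$ denotes its Fraïssé limit, and $\mathrm{Aut}(\mathbb{U}^<_\Delta)$ its group of order-preserving surjective isometries with the topology of pointwise convergence (the underlying set carrying the discrete topology). A triple $(x,y,z)$ of positive reals is a $\Delta$-triangle if $x,y,z\in\Delta$ and $|x-y|\le z\le x+y$; $\Delta$ and $\Lambda$ are equivalent if there is a bijection $f:\Delta\to\Lambda$ such that $(x,y,z)$ is a $\Delta$-triangle iff $(f(x),f(y),f(z))$ is a $\Lambda$-triangle. *)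

(* Defs.v *)
From HB Require Import structures.
From mathcomp Require Import all_boot all_order all_algebra.
From mathcomp Require Import all_classical all_reals all_analysis.

Set Implicit Arguments.
Unset Strict Implicit.
Unset Printing Implicit Defensive.

Import Order.TTheory GRing.Theory Num.Theory.
Local Open Scope classical_set_scope.
Local Open Scope ring_scope.

(* The supremum is taken in the extended reals: the real-valued [sup] is 0 on
   unbounded sets, whereas here min{x + y, sup D} is x + y when D is unbounded. *)
Definition distance_value_set (R : realType) (D : set R) : Prop :=
  (forall x, D x -> 0 < x) /\
  (forall x y, D x -> D y ->
     (EFin @` D) (mine (x + y)%:E (ereal_sup (EFin @` D)))).

Definition triangle (R : realType) (D : set R) (x y z : R) : Prop :=
  [/\ D x, D y & D z] /\ `|x - y| <= z <= x + y.

Definition equivalent (R : realType) (D E : set R) : Prop :=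
  exists2 f : R -> R, set_bij D E f &
    forall x y z, D x -> D y -> D z ->
      (triangle D x y z <-> triangle E (f x) (f y) (f z)).

Record structure (L : Type) := Structure {
  carrier :> Type;
  interp : L -> carrier -> carrier -> Prop }.

Definition embedding (L : Type) (A B : structure L) (f : A -> B) : Prop :=
  injective f /\ forall l x y, interp l x y <-> interp l (f x) (f y).

Definition isomorphism (L : Type) (A B : structure L) (f : A -> B) : Prop :=
  bijective f /\ forall l x y, interp l x y <-> interp l (f x) (f y).

Definition substructure (L : Type) (A : structure L) (S : set A) :
    structure L :=
  @Structure L (set_type S) (fun l x y => interp l (val x) (val y)).

Definition ultrahomogeneous (L : Type) (U : structure L) : Prop :=
  forall (S T : set U) (f : substructure S -> substructure T),
    finite_set S -> finite_set T -> isomorphism f ->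
    exists2 g : U -> U, isomorphism g & forall x : S, g (val x) = val (f x).

Definition age (L : Type) (U A : structure L) : Prop :=
  finite_set [set: A] /\ exists f : A -> U, embedding f.

(* At most countable: for the empty distance value set the limit is a point. *)
Definition fraisse_limit (L : Type) (K : structure L -> Prop)
    (U : structure L) : Prop :=
  [/\ countable [set: U], ultrahomogeneous U & forall A, age U A <-> K A].

Definition metric (R : realType) (T : Type) (d : T -> T -> R) : Prop :=
  [/\ forall x y, 0 <= d x y,
      forall x y, d x y = 0 <-> x = y,
      forall x y, d x y = d y x &
      forall x y z, d x z <= d x y + d y z].

Definition strict_linear_order (T : Type) (lt : T -> T -> Prop) : Prop :=
  [/\ forall x, ~ lt x x,
      forall x y z, lt x y -> lt y z -> lt x z &
      forall x y, x <> y -> lt x y \/ lt y x].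

(* One symbol R_s for each s in D, and one symbol for the strict order. *)
Inductive lang (R : realType) (D : set R) : Type :=
| Dist of set_type D
| Lt.

Definition ordered_metric_space (R : realType) (D : set R)
    (A : structure (lang D)) : Prop :=
  (exists d : A -> A -> R,
     [/\ metric d,
         forall x y, x <> y -> D (d x y) &
         forall (s : D) x y, interp (Dist s) x y <-> d x y = val s]) /\
  strict_linear_order (@interp _ A (Lt D)).

Definition finite_ordered_metric_space (R : realType) (D : set R)
    (A : structure (lang D)) : Prop :=
  finite_set [set: A] /\ ordered_metric_space A.

HB.mixin Record Group_Topological_isTopologicalGroup G
    of Group G & Topological G := {
  mulg_continuous : continuous (fun x : G * G => (x.1 * x.2)%g);
  invg_continuous : continuous (fun x : G => (x^-1)%g) }.

#[short(type="topologicalGroupType")]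
HB.structure Definition TopologicalGroup :=
  { G of Group_Topological_isTopologicalGroup G & Group G & Topological G }.

Definition topological_group_isomorphic (G H : topologicalGroupType) : Prop :=
  exists (f : G -> H) (g : H -> G),
    [/\ cancel f g, cancel g f, {morph f : x y / (x * y)%g},
        continuous f & continuous g].

Record aut (L : Type) (A : structure L) := Aut {
  aut_fun :> A -> A;
  aut_isomorphism : isomorphism aut_fun }.

Section AutGroup.
Variables (L : Type) (A : structure L).
Implicit Types f g h : aut A.

Lemma autP f g : (forall x, f x = g x) -> f = g.
Proof.
case: f g => [f fP] [g gP] /= /funext fg; subst g; congr Aut.
exact: Prop_irrelevance.
Qed.

Lemma aut_one_subproof : isomorphism (@id A).
Proof. by split=> //; exists id. Qed.
Definition aut_one := Aut aut_one_subproof.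

Lemma aut_mul_subproof f g : isomorphism (f \o g).
Proof.
case: f g => [f [bf rf]] [g [bg rg]] /=; split; first exact: bij_comp.
by move=> l x y; rewrite rg rf.
Qed.
Definition aut_mul f g := Aut (aut_mul_subproof f g).

Lemma aut_inv_ex f : exists g : A -> A, cancel f g /\ cancel g f.
Proof. by case: f => [f [[g fg gf] rf]]; exists g. Qed.

Definition aut_inv_fun f : A -> A := projT1 (cid (aut_inv_ex f)).

Lemma aut_funK f : cancel f (aut_inv_fun f).
Proof. by rewrite /aut_inv_fun; case: cid => g []. Qed.

Lemma aut_inv_funK f : cancel (aut_inv_fun f) f.
Proof. by rewrite /aut_inv_fun; case: cid => g []. Qed.

Lemma aut_inv_subproof f : isomorphism (aut_inv_fun f).
Proof.
split; first by exists f; [exact: aut_inv_funK|exact: aut_funK].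
move=> l x y; have := (aut_isomorphism f).2 l (aut_inv_fun f x) (aut_inv_fun f y).
by rewrite !aut_inv_funK; exact: iff_sym.
Qed.
Definition aut_inv f := Aut (aut_inv_subproof f).

HB.instance Definition _ := gen_eqMixin (aut A).
HB.instance Definition _ := gen_choiceMixin (aut A).

Lemma aut_mulA : associative aut_mul. Proof. by move=> f g h; apply: autP. Qed.
Lemma aut_mul1 : left_id aut_one aut_mul. Proof. by move=> f; apply: autP. Qed.
Lemma aut_mulr1 : right_id aut_one aut_mul.
Proof. by move=> f; apply: autP. Qed.
Lemma aut_mulV : left_inverse aut_one aut_inv aut_mul.
Proof. by move=> f; apply: autP => x; exact: aut_funK. Qed.
Lemma aut_mulrV : right_inverse aut_one aut_inv aut_mul.
Proof. by move=> f; apply: autP => x; exact: aut_inv_funK. Qed.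

HB.instance Definition _ := isGroup.Build (aut A)
  aut_mulA aut_mul1 aut_mulr1 aut_mulV aut_mulrV.

Definition aut_ptws f : {ptws A -> discrete_topology {classic A}} := aut_fun f.

HB.instance Definition _ :=
  Topological.copy (aut A) (initial_topology aut_ptws).

Lemma aut_cvgP (F : set_system (aut A)) f : Filter F ->
  F --> f <-> forall x, F [set g : aut A | g x = f x].
Proof.
move=> FF; split=> [Ff x|Ff].
  apply: Ff; pose e (g : {ptws A -> discrete_topology {classic A}}) := g x.
  have : nbhs (aut_ptws f) (e @^-1` [set e (aut_ptws f)]).
    have /cvg_sup/(_ x) : nbhs (aut_ptws f) --> aut_ptws f by [].
    apply; exists (e @^-1` [set e (aut_ptws f)]); split => //.
    by exists [set e (aut_ptws f)] => //; exact: discrete_open.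
  exact: (@initial_continuous (aut A) _ aut_ptws f).
move=> W [_ [[B Bo <-] Bf BW]]; apply: filterS BW _.
suff : aut_ptws @ F --> aut_ptws f by apply; exact: open_nbhs_nbhs.
apply/cvg_sup => x V [_ [[C Co <-] Cf CV]].
apply: (@filterS _ F _ [set g : aut A | g x = f x]) (Ff x) => g /= gx.
by apply: CV; rewrite /= /aut_ptws gx.
Qed.

Lemma aut_nbhs f x : nbhs f [set g : aut A | g x = f x].
Proof. by move: x; apply/aut_cvgP. Qed.

Lemma aut_mul_continuous : continuous (fun x : aut A * aut A => (x.1 * x.2)%g).
Proof.
move=> [f g]; apply/aut_cvgP => x.
exists ([set h : aut A | h (g x) = f (g x)], [set h : aut A | h x = g x]).
  by split; exact: aut_nbhs.
by case=> h k [/= hE kE]; rewrite kE hE.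
Qed.

Lemma aut_inv_continuous : continuous (fun x : aut A => (x^-1)%g).
Proof.
move=> f; apply/aut_cvgP; first exact/fmap_filter/nbhs_filter.
move=> x; apply: filterS (aut_nbhs f (aut_inv_fun f x)).
by move=> g /= gE; rewrite -{1}(aut_inv_funK f x) -gE aut_funK.
Qed.

HB.instance Definition _ := Group_Topological_isTopologicalGroup.Build (aut A)
  aut_mul_continuous aut_inv_continuous.

End AutGroup.

(* Main.v *)
(** A Fraisse limit is characterised by a one-point extension property and by
the homogeneity of its finite subsets. If [Delta] and [Lambda] are equivalent,
relabelling the distances turns the extension property of one limit into that
of the other, and a back-and-forth argument yields an order isomorphism [U -> V]
along which automorphisms are conjugated.

Conversely, every proper open subgroup [H] of [aut U] fixes a point. Indeed, let
[H] contain the pointwise stabilizer of a finite set [l], let [b] be the least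
element of [l] and [m := l \ {b}]. If [h] in [H] moves [b], then up to inverting
[h] we have [b < h b], so [b] does not belong to [h l], and [H] contains the
stabilizer of the finite set [m + h l], which still moves [b]. Doubling distances
then shows that [H] contains the stabilizer of the smaller set [m]. Hence a
topological isomorphism matches point stabilizers with point stabilizers, which
gives an equivariant bijection [U -> V]. The orbits of unordered pairs are the
distances, so this bijection induces a bijection [Delta -> Lambda], and it
preserves triangles because these are the triples of distances realized by three
points. *)

Require Import Defs.
From mathcomp Require Import all_boot all_order all_algebra.
From mathcomp Require Import all_classical all_reals all_analysis.
From mathcomp Require Import lra.

Set Implicit Arguments.
Unset Strict Implicit.
Unset Printing Implicit Defensive.

Import Order.TTheory GRing.Theory Num.Theory.
Local Open Scope classical_set_scope.
Local Open Scope ring_scope.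

(** * Finite sets given as lists or subtypes, and a fixed distance *)

Lemma finite_set_type (T : Type) (S : set T) :
  finite_set S -> finite_set [set: set_type S].
Proof.
move=> Sfin; have -> : [set: set_type S] = val @^-1` S.
  by apply/seteqP; split=> // x _; exact: set_valP.
by apply: finite_preimage Sfin => x y _ _; exact: val_inj.
Qed.

Lemma finite_list_set (T : Type) (l : seq T) :
  finite_set [set x | List.In x l].
Proof.
elim: l => [|a l IHl]; first exact: (sub_finite_set _ (finite_set0 T)).
apply: (@sub_finite_set _ _ ([set a] `|` [set x | List.In x l])).
  by move=> x /= [<-|]; [left|right].
by rewrite finite_setU.
Qed.

Definition distance_of (R : realType) (D : set R) (U : structure (lang D))
    (d : U -> U -> R) : Prop :=
  [/\ metric d, forall x y, x <> y -> D (d x y) &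
      forall (s : D) x y, interp (Dist s) x y <-> d x y = val s].

(** * Extension and homogeneity properties of a Fraisse limit *)

Section FraisseLimitExtension.
Variables (R : realType) (D : set R) (U : structure (lang D)).
Hypothesis Dpos : forall x, D x -> 0 < x.
Hypothesis hU : fraisse_limit (@finite_ordered_metric_space R D) U.

Let ordered_triple (x y z : U) :
  exists (A : structure (lang D)) (v : A -> U),
    [/\ injective v, forall l p q, interp l p q <-> interp l (v p) (v q),
        ordered_metric_space A & exists a b c, [/\ v a = x, v b = y & v c = z]].
Proof.
pose S := [set x; y; z].
have [xS yS zS] : [/\ x \in S, y \in S & z \in S].
  by split; apply/mem_set; rewrite /S /=; tauto.
have [_ _ hage] := hU.
exists (substructure S), val; split=> //.
  apply: (proj2 (proj1 (hage (substructure S)) _)).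
  split; first exact/finite_set_type/finite_set3.
  by exists val.
by exists (SigSub xS), (SigSub yS), (SigSub zS).
Qed.

(** Each axiom involves at most three points of [U], so it can be checked in a substructure on three
    points, which belongs to the age. *)
Lemma fraisse_limit_ordered : ordered_metric_space U.
Proof.
(* The default value [0] is right because distinct points always satisfy some [Dist s], as [dE]
   shows. *)
pose d (x y : U) :=
  if pselect (exists s : D, interp (Dist s) x y) is left h
  then val (projT1 (cid h)) else 0.
have dE (A : structure (lang D)) (v : A -> U) (dA : A -> A -> R) :
    (forall l p q, interp l p q <-> interp l (v p) (v q)) -> distance_of dA ->
    forall p q, dA p q = d (v p) (v q).
  move=> vP [[_ dA0 _ _] dAD dAP] p q; rewrite /d; case: pselect => [h|nh].
    by case: (cid h) => s /= sP; apply/dAP; rewrite vP.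
  have [<-|pq] := pselect (p = q); first exact/dA0.
  case: nh; exists (SigSub (mem_set (dAD _ _ pq))).
  by rewrite -vP dAP.
have lt3 x y z : exists (A : structure (lang D)) (v : A -> U) dA,
    [/\ injective v, forall l p q, interp l p q <-> interp l (v p) (v q),
        distance_of dA, forall p q, dA p q = d (v p) (v q) &
        strict_linear_order (@interp _ A (Lt D)) /\
        exists a b c, [/\ v a = x, v b = y & v c = z]].
  have [A [v [vinj vP [[dA dAP] ltA] ex]]] := ordered_triple x y z.
  by exists A, v, dA; split=> //; exact: dE.
split.
  exists d; split.
  - split=> [x y|x y|x y|x y z].
    + have [A [v [dA [vinj vP [[p1 p2 p3 p4] _ _] E [_ [a [b [c [<- <- _]]]]]]]]] :=
        lt3 x y x.
      by rewrite -E.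
    + have [A [v [dA [vinj vP [[p1 p2 p3 p4] _ _] E [_ [a [b [c [<- <- _]]]]]]]]] :=
        lt3 x y x.
      by rewrite -E p2; split=> [->//|/vinj].
    + have [A [v [dA [vinj vP [[p1 p2 p3 p4] _ _] E [_ [a [b [c [<- <- _]]]]]]]]] :=
        lt3 x y x.
      by rewrite -!E.
    + have [A [v [dA [vinj vP [[p1 p2 p3 p4] _ _] E [_ [a [b [c [<- <- <-]]]]]]]]] :=
        lt3 x y z.
      by rewrite -!E.
  - move=> x y.
    have [A [v [dA [vinj vP [_ p5 _] E [_ [a [b [c [<- <- _]]]]]]]]] := lt3 x y x.
    by move=> ab; rewrite -E; apply: p5 => eab; apply: ab; rewrite eab.
  - move=> s x y.
    have [A [v [dA [vinj vP [_ _ p6] E [_ [a [b [c [<- <- _]]]]]]]]] := lt3 x y x.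
    by rewrite -vP -E.
split=> [x|x y z|x y].
- have [A [v [dA [vinj vP _ E [[q1 q2 q3] [a [b [c [<- _ _]]]]]]]]] := lt3 x x x.
  by rewrite -vP; exact: q1.
- have [A [v [dA [vinj vP _ E [[q1 q2 q3] [a [b [c [<- <- <-]]]]]]]]] := lt3 x y z.
  by rewrite -!vP; exact: q2.
- have [A [v [dA [vinj vP _ E [[q1 q2 q3] [a [b [c [<- <- _]]]]]]]]] := lt3 x y x.
  by rewrite -!vP => ab; apply: q3 => eab; apply: ab; rewrite eab.
Qed.

Local Notation lt := (@interp _ U (Lt D)).

(** Preserving the strict linear order makes [f] injective on [S], hence an isomorphism onto its
    image, and ultrahomogeneity extends it. *)
Lemma fraisse_limit_homogeneous (S : set U) (f : U -> U) : finite_set S ->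
    (forall l x y, S x -> S y -> interp l x y <-> interp l (f x) (f y)) ->
  exists g : aut U, forall x, S x -> g x = f x.
Proof.
move=> Sfin fP; have [_ hom _] := hU.
have [_ [irr _ tot]] := fraisse_limit_ordered.
have finj x y : S x -> S y -> f x = f y -> x = y.
  move=> Sx Sy fxy; apply: contrapT => /tot[xy|yx]; apply: (irr (f x)).
    by rewrite {2}fxy; exact: (proj1 (fP _ _ _ Sx Sy) xy).
  by rewrite {1}fxy; exact: (proj1 (fP _ _ _ Sy Sx) yx).
have fS (x : S) : f (val x) \in f @` S.
  by apply/mem_set; exists (val x) => //; exact: (set_valP x).
pose h (x : substructure S) : substructure (f @` S) := SigSub (fS x).
have [|g gP gh] := hom S (f @` S) h Sfin (finite_image _ Sfin).
  split; last by move=> l x y; apply: fP; exact: set_valP.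
  have pre (y : substructure (f @` S)) : exists x : substructure S, h x = y.
    have [x Sx xy] := set_valP y.
    by exists (SigSub (mem_set Sx)); apply: val_inj.
  have [k kP] := choice pre.
  exists k => // x; apply: val_inj; apply: finj; try exact: set_valP.
  by have /(congr1 val) := kP (h x).
exists (Aut gP) => x Sx /=.
by have := gh (SigSub (mem_set Sx)).
Qed.

(** Adjoining to [l] a point with distances [p] and predecessors [L] gives a finite ordered metric
    space, which therefore embeds in [U]; homogeneity then moves the embedded copy of [l] back onto
    [l]. *)
Lemma fraisse_limit_one_point_extension (d : U -> U -> R) (l : seq U)
    (p : U -> R) (L : U -> Prop) : distance_of d ->
    (forall x, List.In x l -> D (p x)) ->
    (forall x y, List.In x l -> List.In y l -> `|p x - p y| <= d x y <= p x + p y) ->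
    (forall x y, List.In x l -> List.In y l -> lt x y -> L y -> L x) ->
  exists z, forall x, List.In x l -> d z x = p x /\ (lt x z <-> L x).
Proof.
move=> [[d0 dE0 dC dT] dD dP] pD pT LP.
have [_ [irr trans tot]] := fraisse_limit_ordered.
have [_ _ hage] := hU.
pose S := [set x | List.In x l].
pose dA (x y : option S) : R := match x, y with
  | Some x, Some y => d (val x) (val y)
  | None, Some y => p (val y) | Some x, None => p (val x) | None, None => 0 end.
pose ltA (x y : option S) : Prop := match x, y with
  | Some x, Some y => lt (val x) (val y)
  | None, Some y => ~ L (val y) | Some x, None => L (val x) | None, None => False end.
pose A := @Structure (lang D) (option S) (fun s x y =>
  match s with Dist s => dA x y = val s | Lt => ltA x y end).
have inl (x : S) : List.In (val x) l by exact: (set_valP x).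
have ppos (x : S) : 0 < p (val x) by exact/Dpos/pD/inl.
have /(hage A)[_ [e [einj eP]]] : finite_ordered_metric_space A.
  split.
    apply: (@sub_finite_set _ _ ([set None] `|` Some @` [set: S])).
      by case=> [x|] _; [right; exists x|left].
    rewrite finite_setU; split => //.
    exact/finite_image/finite_set_type/finite_list_set.
  split.
    exists dA; split=> //.
    - split.
      + by move=> [x|] [y|] /=; first [exact: d0|exact/ltW/ppos|exact: lexx].
      + move=> [x|] [y|] //=.
        * by rewrite dE0; split=> [/val_inj->|[->]].
        * by split=> // px; have := ppos x; rewrite px ltxx.
        * by split=> // px; have := ppos y; rewrite px ltxx.
      + by move=> [x|] [y|] /=.
      + move=> [x|] [y|] [z|] /=.
        * exact: dT.
        * have /andP[+ _] := pT _ _ (inl x) (inl y).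
          by rewrite ler_norml; lra.
        * by have /andP[_] := pT _ _ (inl x) (inl z).
        * by have := ppos x; lra.
        * have /andP[+ _] := pT _ _ (inl y) (inl z).
          by rewrite ler_norml; lra.
        * by have := ppos y; lra.
        * by lra.
        * by lra.
    - move=> [x|] [y|] //= xy; try exact/pD/inl.
      by apply: dD => exy; apply: xy; congr Some; exact: val_inj.
  split=> [[x|]|[x|] [y|] [z|]|[x|] [y|]] //=.
  - exact: trans.
  - exact: LP (inl x) (inl y).
  - move=> Lx nLz; have [//|zx] : lt (val x) (val z) \/ lt (val z) (val x).
      by apply: tot => xz; apply: nLz; rewrite -xz.
    by case: nLz; exact: LP (inl z) (inl x) zx Lx.
  - by move=> nLy yz Lz; apply: nLy; exact: LP (inl y) (inl z) yz Lz.
  - by move=> xy; apply: tot => exy; apply: xy; congr Some; exact: val_inj.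
  - by move=> _; exact: EM.
  - by move=> _; exact/or_comm/EM.
(* [k] sends [l] to its copy under [e]; its values elsewhere do not matter. Some [g] extends it, and
   the preimage under [g] of the new point is the witness. *)
pose k (u : U) : U := if pselect (List.In u l) is left ul
  then e (Some (SigSub (mem_set (ul : S u)) : S)) else u.
have kE (x : S) : k (val x) = e (Some x).
  rewrite /k; case: pselect (inl x) => // ul _; congr (e (Some _)).
  exact: val_inj.
have [|g gE] := @fraisse_limit_homogeneous S k (finite_list_set _).
  move=> s x y Sx Sy.
  rewrite (kE (SigSub (mem_set Sx))) (kE (SigSub (mem_set Sy))).
  by rewrite -eP /=; case: s => [s|]; rewrite ?dP.
exists (aut_inv_fun g (e None)) => x xl.
have gz : g (aut_inv_fun g (e None)) = e None by exact: aut_inv_funK.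
pose x' : S := SigSub (mem_set (xl : S x)).
have gx : g x = e (Some x') by rewrite gE // -kE.
have [_ gP] := aut_isomorphism g.
split.
  pose s : D := SigSub (mem_set (pD x xl)).
  by have /dP : interp (Dist s) (aut_inv_fun g (e None)) x
    by rewrite gP gz gx -eP.
by rewrite gP gz gx -eP.
Qed.

End FraisseLimitExtension.

(** * Doubling distances, and neighbourhoods of the identity *)

Lemma distance_value_set_double (R : realType) (D : set R) (t : R) :
    distance_value_set D -> D t ->
  exists u, [/\ D u, t <= u, u <= t + t &
                forall s, D s -> s <= u \/ t + t <= u].
Proof.
move=> [Dpos Dsum] Dt; have [u Du uE] := Dsum _ _ Dt Dt.
have sup_ge s : D s -> (s%:E <= ereal_sup (EFin @` D))%E.
  by move=> Ds; apply: ereal_sup_ubound; exists s.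
have tpos := Dpos _ Dt.
(* The minimum is either [t + t] or the supremum; in the second case the supremum is attained and
   bounds [D]. *)
move: uE; rewrite /mine; case: ifP => [_ [uE]|/negbT].
  by exists u; split=> // [||s _]; rewrite uE; [lra| |right].
rewrite -leNgt => supt uE; move: supt sup_ge; rewrite -uE lee_fin => ut supu.
by exists u; split=> // [|s Ds]; [|left]; rewrite -lee_fin supu.
Qed.

(** The sets containing the stabilizer of some list form a filter; it converges to the identity by
    [aut_cvgP], so it contains every neighbourhood. *)
Lemma aut_nbhs1P (L : Type) (A : structure L) (W : set (aut A)) :
    nbhs (1%g : aut A) W ->
  exists l : seq A, forall g : aut A, (forall x, List.In x l -> g x = x) -> W g.
Proof.
pose F : set_system (aut A) := [set W | exists l : seq A,
  forall g : aut A, (forall x, List.In x l -> g x = x) -> W g].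
have FF : Filter F.
  split.
  - by exists [::].
  - move=> P Q [l lP] [m mQ]; exists (l ++ m) => g gP.
    split; [apply: lP|apply: mQ] => x xl; apply: gP; apply/List.in_or_app; tauto.
  - by move=> P Q PQ [l lP]; exists l => g gl; exact/PQ/lP.
have /(_ W) : F --> (1%g : aut A).
  by apply/aut_cvgP => x; exists [:: x] => g /(_ x); apply; left.
exact.
Qed.

Section AutomorphismGroup.
Variables (L : Type) (U : structure L).

Lemma aut_mulE (g h : aut U) x : (g * h)%g x = g (h x). Proof. by []. Qed.
Lemma aut_invK (g : aut U) x : (g^-1)%g (g x) = x.
Proof. exact: aut_funK. Qed.
Lemma aut_invVK (g : aut U) x : g ((g^-1)%g x) = x.
Proof. exact: aut_inv_funK. Qed.

Definition aut_subgroup (H : set (aut U)) : Prop :=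
  [/\ H 1%g, forall g h, H g -> H h -> H (g * h)%g &
      forall g, H g -> H (g^-1)%g].

End AutomorphismGroup.

(** * Open subgroups of the automorphism group of a limit *)

Section LimitAutomorphisms.
Variables (R : realType) (D : set R) (U : structure (lang D)).
Hypothesis hD : distance_value_set D.
Hypothesis hU : fraisse_limit (@finite_ordered_metric_space R D) U.
Variable d : U -> U -> R.
Hypothesis hd : distance_of d.

Local Notation lt := (@interp _ U (Lt D)).
Local Notation fixes l g := (forall x, List.In x l -> aut_fun g x = x).

Let Dpos : forall x, D x -> 0 < x := hD.1.

Lemma dist_ge0 x y : 0 <= d x y. Proof. by case: hd => -[]. Qed.
Lemma dist_eq0 x y : d x y = 0 <-> x = y. Proof. by case: hd => -[]. Qed.
Lemma distxx x : d x x = 0. Proof. exact/dist_eq0. Qed.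
Lemma distC x y : d x y = d y x. Proof. by case: hd => -[]. Qed.
Lemma dist_triangle x y z : d x z <= d x y + d y z.
Proof. by case: hd => -[]. Qed.
Lemma dist_in x y : x <> y -> D (d x y). Proof. by case: hd => _ + _; exact. Qed.

Lemma limit_ltxx x : ~ lt x x.
Proof. by have [_ []] := fraisse_limit_ordered hU. Qed.
Lemma limit_lt_trans x y z : lt x y -> lt y z -> lt x z.
Proof. by have [_ [_ + _]] := fraisse_limit_ordered hU; exact. Qed.
Lemma limit_lt_total x y : x <> y -> lt x y \/ lt y x.
Proof. by have [_ [_ _]] := fraisse_limit_ordered hU; exact. Qed.
Lemma limit_ltN x y : x <> y -> lt x y <-> ~ lt y x.
Proof.
move=> xy; split=> [ltxy ltyx|]; first exact: limit_ltxx (limit_lt_trans ltxy ltyx).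
by case: (limit_lt_total xy).
Qed.

Lemma aut_dist (g : aut U) x y : d (g x) (g y) = d x y.
Proof.
have [<-|xy] := pselect (x = y); first by rewrite !distxx.
have [_ _ dP] := hd; have [_ gP] := aut_isomorphism g.
pose s : D := SigSub (mem_set (dist_in xy)).
by apply/(dP s); rewrite -gP dP.
Qed.

Lemma aut_lt (g : aut U) x y : lt (g x) (g y) <-> lt x y.
Proof. by have [_ gP] := aut_isomorphism g; rewrite -gP. Qed.

(** Distances to [l] and the cut in [l] determine the type of a point over [l], so fixing [l] and
    sending [x] to [y] is a finite partial isomorphism. *)
Lemma aut_move_point (l : seq U) x y : ~ List.In x l -> ~ List.In y l ->
    (forall c, List.In c l -> d x c = d y c /\ (lt c x <-> lt c y)) ->
  exists g : aut U, fixes l g /\ g x = y.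
Proof.
move=> xl yl xy.
have neq z c : ~ List.In z l -> List.In c l -> z <> c by move=> zl cl zc; subst.
have xyr c : List.In c l -> lt x c <-> lt y c.
  move=> cl; rewrite (limit_ltN (neq _ _ xl cl)) (limit_ltN (neq _ _ yl cl)).
  by rewrite (xy _ cl).2.
pose f u := if pselect (u = x) is left _ then y else u.
have fx : f x = y by rewrite /f; case: pselect.
have fc c : List.In c l -> f c = c.
  by rewrite /f; case: pselect => // ->.
have [||g gP] := fraisse_limit_homogeneous hU
  (S := [set u | List.In u (x :: l)]) (f := f).
- exact: finite_list_set.
- case=> [s|] u v /= [<-|ul] [<-|vl]; rewrite ?fx ?fc //.
  + have [_ _ dP] := hd; rewrite !dP.
    by rewrite !distxx.
  + have [_ _ dP] := hd; rewrite !dP.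
    by rewrite (xy _ vl).1.
  + have [_ _ dP] := hd; rewrite !dP.
    by rewrite ![d u _]distC (xy _ ul).1.
  + by split=> /limit_ltxx.
  + exact: xyr.
  + exact: (xy _ ul).2.
exists g; split=> [c cl|]; last by rewrite gP //=; left.
by rewrite gP /= ?fc//; right.
Qed.

(* For [y := b] this is a conjugate of [b] over [l] at distance [t]. *)
Lemma twin_point (l : seq U) b y t : ~ List.In b l -> ~ List.In y l -> D t ->
    (forall c, List.In c l -> d b c = d y c) ->
    (forall c, List.In c l -> t <= d b c + d b c) -> d b y <= t + t ->
  exists z, [/\ d z b = t, d z y = t, lt b z &
    forall c, List.In c l -> d z c = d b c /\ (lt c z <-> lt c b)].
Proof.
move=> bl yl Dt bC tC tby.
have neq c : List.In c l -> c <> b by move=> cl cb; subst.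
pose p u := if pselect (List.In u l) is left _ then d b u else t.
have pl c : List.In c l -> p c = d b c by rewrite /p; case: pselect.
have pN c : ~ List.In c l -> p c = t by rewrite /p; case: pselect.
have tpos := Dpos Dt.
(* The new point is placed just after [b]: its predecessors among the listed points are [b] and
   those not above [b]. *)
have [|||z zP] := fraisse_limit_one_point_extension Dpos hU (d := d)
  (l := b :: y :: l) (p := p) (L := fun x => ~ lt b x) hd.
- move=> x /= [<-|[<-|xl]]; [by rewrite pN|by rewrite pN|rewrite pl//].
  by apply: dist_in => bx; exact: (neq _ xl).
- move=> x x' xin x'in.
  (* The condition is symmetric. A point [c] of [l] against [b] or [y] requires
     [t <= d b c + d b c], and the pair [b], [y] requires [d b y <= t + t]. *)
  wlog : x x' xin x'in / (x' = b \/ x' = y) \/ (List.In x l /\ List.In x' l).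
    move=> W.
    have [xl|xl] := pselect (List.In x l); have [x'l|x'l] := pselect (List.In x' l).
    + by apply: W => //; right.
    + by apply: W => //; left; case: x'in => [|[|/x'l]]//; auto.
    + rewrite distC distrC [p x + _]addrC; apply: W => //; left.
      by case: xin => [|[|/xl]]//; auto.
    + by apply: W => //; left; case: x'in => [|[|/x'l]]//; auto.
  move=> [x'by|[xl x'l]]; last first.
    rewrite !pl// ler_norml; have := dist_triangle b x x'.
    have := dist_triangle b x' x; have := dist_triangle x b x'.
    by rewrite [d x' x]distC [d x b]distC; lra.
  have -> : p x' = t by case: x'by => ->; rewrite pN.
  have [xl|xl] := pselect (List.In x l).
    have -> : d x x' = d b x.
      by rewrite distC; case: x'by => ->; rewrite ?bC.
    by rewrite pl// ler_norml; have := tC _ xl; lra.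
  rewrite pN// subrr normr0 dist_ge0 /=.
  by case: x'by => ->; case: xin => [<-|[<-|/xl]]//; rewrite ?distxx 1?distC; lra.
- by move=> x x' _ _ xx' bx' bx; apply: bx'; exact: limit_lt_trans bx xx'.
have [zb bz] := zP b (or_introl erefl).
have [zy _] := zP y (or_intror (or_introl erefl)).
exists z; split; rewrite ?zb ?zy ?pN//; first by apply/bz/limit_ltxx.
move=> c cl; have [-> ->] := zP c (or_intror (or_intror cl)).
by rewrite pl// -limit_ltN//; exact: neq.
Qed.

Lemma small_distance (l : seq U) b : D !=set0 -> ~ List.In b l ->
  exists2 t, D t & forall c, List.In c l -> t <= d b c.
Proof.
move=> [s Ds]; elim: l => [|a l IHl] /= bl; first by exists s.
have [|t Dt tl] := IHl; first by move=> bl'; apply: bl; right.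
have Dba : D (d b a) by apply: dist_in => ba; apply: bl; left.
have [ta|at_] := leP t (d b a).
  by exists t => // c [<-|/tl].
by exists (d b a) => // c [<-//|/tl]; apply: le_trans; exact: ltW.
Qed.

(** A twin of [b] over [l], at a distance no larger than those from [b] to [l], is a conjugate other
    than [b]. *)
Lemma aut_moves (l : seq U) b : D !=set0 -> ~ List.In b l ->
  exists g : aut U, fixes l g /\ g b <> b.
Proof.
move=> D0 bl; have [t Dt tl] := small_distance D0 bl.
have [|||z [zb _ _ zl]] := twin_point bl bl Dt => //.
- by move=> c /tl tc; have := dist_ge0 b c; lra.
- by rewrite distxx; have := Dpos Dt; lra.
have [||g [gl gb]] := @aut_move_point l b z bl.
- by move=> /zl[+ _]; rewrite distxx => /esym/dist_eq0 bz; move: zb;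
    rewrite bz distxx => t0; have := Dpos Dt; rewrite -t0 ltxx.
- by move=> c /zl[-> ->].
exists g; split=> // gbb; move: zb; rewrite -gb gbb distxx => t0.
by have := Dpos Dt; rewrite -t0 ltxx.
Qed.


(* The pairs of realizations of [tp(b/l)] at distance [t] in a given order form
   one orbit of the stabilizer of [l], so [H] absorbs all automorphisms moving [b]
   by at most some [t0 > 0]; a midpoint of type [tp(b/l)] then doubles [t0]. *)
Lemma stabilizer_sub (H : set (aut U)) (l m : seq U) b : D !=set0 ->
    aut_subgroup H -> ~ List.In b m -> (forall c, List.In c l -> List.In c m) ->
    (forall g : aut U, fixes m g -> H g) ->
    (forall g : aut U, fixes (b :: l) g -> H g) ->
  forall g : aut U, fixes l g -> H g.
Proof.
move=> D0 [H1 HM HV] bm lm Hm Hbl g gl.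
have bl : ~ List.In b l by move/lm.
have invl (k : aut U) : fixes l k -> fixes l (k^-1)%g.
  by move=> kl c cl; rewrite -{1}(kl c cl) aut_invK.
have mull (h k : aut U) : fixes l h -> fixes l k -> fixes l (h * k)%g.
  by move=> hl kl c cl; rewrite aut_mulE kl// hl.
have gbl (k : aut U) : fixes l k -> ~ List.In (k b) l.
  by move=> kl kbl; apply: bl; rewrite -(aut_invK k b) invl.
have dgl (k : aut U) c : fixes l k -> List.In c l -> d b c = d (k b) c.
  by move=> kl cl; rewrite -{2}(kl c cl) aut_dist.
have ltgl (k : aut U) c : fixes l k -> List.In c l -> lt c (k b) <-> lt c b.
  by move=> kl cl; rewrite -{1}(kl c cl) aut_lt.
(* Here [h^-1 * k] fixes [b :: l], so membership in [H] depends only on the image of [b]. *)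
have coset (h k : aut U) : fixes l h -> fixes l k -> H h -> h b = k b -> H k.
  move=> hl kl Hh hk; rewrite -(mulVKg h k); apply: HM => //; apply: Hbl.
  move=> c [<-|cl]; first by rewrite aut_mulE -hk aut_invK.
  by apply: mull => //; exact: invl.
pose Q t := forall k : aut U, fixes l k -> d b (k b) <= t -> H k.
have [t0 Dt0 t0m] := small_distance D0 bm.
have Q0 : Q t0.
  move=> k0 k0l k0t0.
  wlog bk0 : k0 k0l k0t0 / lt b (k0 b).
    move=> W; have [bk|] := pselect (b = k0 b).
      by apply: Hbl => c /= [<-|/k0l].
    case/limit_lt_total; first exact: W.
    move=> k0b; rewrite -[k0]invgK; apply: HV; apply: W; first exact: invl.
      by rewrite -(aut_dist k0) aut_invVK distC.
    by rewrite -(aut_lt k0) aut_invVK.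
  have Dk0 : D (d b (k0 b)).
    by apply: dist_in => bk; rewrite -bk in bk0; exact: limit_ltxx bk0.
  (* The twin is taken over the larger list [m], so the [h] moving [b] to [z] lies in [H]. An
     automorphism fixing [b :: l] then carries [z] to [k0 b]. *)
  have [|||z [zb _ bz zm]] := twin_point bm bm Dk0 => //.
  - by move=> c /t0m; have := dist_ge0 b c; lra.
  - by rewrite distxx; have := Dpos Dk0; lra.
  have [||h [hm hb]] := @aut_move_point m b z bm.
  - move=> /zm[+ _]; rewrite distxx => /esym/dist_eq0 bz'.
    by rewrite -bz' in bz; exact: limit_ltxx bz.
  - by move=> c /zm[-> ->].
  have hl : fixes l h by move=> c /lm; exact: hm.
  have nin (k : aut U) : fixes l k -> lt b (k b) -> ~ List.In (k b) (b :: l).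
    by move=> kl bk /= [kb|]; [rewrite -kb in bk; exact: limit_ltxx bk|exact: gbl].
  have [|||k [kbl kz]] := @aut_move_point (b :: l) z (k0 b).
  - by rewrite -hb; apply: nin => //; rewrite hb.
  - exact: nin.
  - move=> c /= [<-|cl]; last first.
      by rewrite (ltgl k0)// -(dgl k0)//; apply: zm; exact: lm.
    by rewrite zb [in RHS]distC.
  have kl : fixes l k by move=> c cl; apply: kbl; right.
  apply: (coset (k * h)%g); [exact: mull|by []| |by rewrite aut_mulE hb].
  by apply: HM; [exact: Hbl|exact: Hm].
have Qdouble t u : D t -> u <= t + t -> Q t -> Q u.
  move=> Dt ut Qt k kl ku.
  (* Through such a [c], every conjugate of [b] over [l] is already within [t] of [b]; otherwise
     [twin_point] provides the midpoint. *)
  have [[c [cl tc]]|nc] := pselect (exists c, List.In c l /\ d b c + d b c < t).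
    apply: Qt => //; have := dist_triangle b c (k b).
    by rewrite [d c _]distC -(dgl k)//; lra.
  have [|||z [zb zk bz zl]] := twin_point bl (gbl _ kl) Dt.
  - by move=> c cl; exact: dgl.
  - by move=> c cl; rewrite leNgt; apply/negP => tc; apply: nc; exists c.
  - by lra.
  have [||h [hl hb]] := @aut_move_point l b z bl.
  - move=> /zl[+ _]; rewrite distxx => /esym/dist_eq0 bz'.
    by rewrite -bz' in bz; exact: limit_ltxx bz.
  - by move=> c /zl[-> ->].
  (* Both [h] and [h^-1 * k] move [b] by exactly [t], since [h b = z] is the midpoint. *)
  rewrite -(mulVKg h k); apply: HM; first by apply: Qt => //; rewrite hb distC zb.
  apply: Qt; first by apply: mull => //; exact: invl.
  by rewrite -(aut_dist h) aut_mulE aut_invVK hb zk.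
have [gb|gb] := pselect (b = g b); first by apply: Hbl => c /= [<-|/gl].
have Ds := dist_in gb.
(* Each doubling either reaches [d b (g b)], when capped by the supremum, or gains at least [t0];
   the archimedean property ends the process. *)
have large n : exists t, [/\ D t, t0 <= t, Q t & d b (g b) <= t \/ t0 *+ n <= t].
  elim: n => [|n [t [Dt t0t Qt tn]]].
    by exists t0; split=> //; right; rewrite mulr0n; exact/ltW/Dpos.
  have [u [Du tu utt uP]] := distance_value_set_double hD Dt.
  exists u; split=> //; [exact: le_trans tu|exact: Qdouble Qt|].
  have [|ttu] := uP _ Ds; first by left.
  by case: tn => [|tn]; [left; lra|right; rewrite mulrS; lra].
have [n sn] : exists n, d b (g b) <= t0 *+ n.
  exists (Num.bound (d b (g b) / t0)); rewrite -mulr_natr mulrC -ler_pdivrMr ?Dpos//.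
  by apply/ltW/archi_boundP/divr_ge0; [exact: dist_ge0|exact/ltW/Dpos].
have [t [_ _ Qt tn]] := large n; apply: Qt => //.
by case: tn => //; exact: le_trans.
Qed.

(** Lists may repeat entries, so [b] can still occur in [m]; only the length is sure to drop, which
    is what the induction on open subgroups uses. *)
Lemma list_min a (l : seq U) : exists b m,
  [/\ size m = size l, forall x, List.In x (a :: l) <-> x = b \/ List.In x m &
      forall x, List.In x (a :: l) -> ~ lt x b].
Proof.
elim: l a => [|a' l IHl] a.
  exists a, [::]; split=> // x /=; first by split=> [[->|//]|[->|//]]; left.
  by case=> // <-; exact: limit_ltxx.
have [b [m [sm mP bmin]]] := IHl a'.
have [ab|ab] := pselect (lt a b).
  exists a, (a' :: l); split=> // x /=.
    by split=> [[->|]|[->|]]; tauto.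
  case=> [<-|]; first exact: limit_ltxx.
  by move=> /bmin xb xa; apply: xb; exact: limit_lt_trans xa ab.
exists b, (a :: m); split=> [|x|x] /=.
- by rewrite sm.
- by have := mP x => /=; intuition.
- by case=> [<-//|/bmin].
Qed.

Lemma open_subgroup_fixed_point (H : set (aut U)) : D !=set0 ->
    aut_subgroup H -> nbhs (1%g : aut U) H -> (exists g, ~ H g) ->
  exists b, forall h : aut U, H h -> h b = b.
Proof.
move=> D0 HG /aut_nbhs1P[l Hl] [g0 Hg0].
have [H1 HM HV] := HG.
elim: {l}(size l) {-2}l (leqnn (size l)) Hl => [|n IHn] [|a l] //=.
(* For the empty list, [H] would be the whole group. *)
1,2: by move=> _ Hl; case: Hg0; exact: Hl.
rewrite ltnS => ln Hal; have [b [m [sm mP bmin]]] := list_min a l.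
have mn : (size m <= n)%N by rewrite sm.
apply: contrapT => nofix.
have Hbm (g : aut U) : fixes (b :: m) g -> H g.
  move=> gbm; apply: Hal => x /mP[->|xm]; apply: gbm; [by left|by right].
have [bm|bm] := pselect (List.In b m).
  by apply/nofix/(IHn m) => // g gm; apply: Hbm => x /= [<-|]; exact: gm.
have [h Hh bh] : exists2 h : aut U, H h & lt b (h b).
  have /existsNP[h /not_implyP[Hh hb]] := proj2 (forallNP _) nofix b.
  have [hbb|] := limit_lt_total hb; last by exists h.
  by exists (h^-1)%g; [exact: HV|rewrite -(aut_lt h) aut_invVK].
apply/nofix/(IHn m) => //.
(* The larger list avoids [b]: if [h x = b], then [h x] lies below [h b], so [x] lies below the
   minimum [b]. Its stabilizer lies in [H] after conjugation by [h]. *)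
apply: (@stabilizer_sub H m (m ++ [seq h x | x <- a :: l]) b) => //.
- move=> /(@List.in_app_or U)[//|].
  move=> /(proj1 (List.in_map_iff (aut_fun h) (a :: l) b))[x [hx xl]].
  by apply: (bmin x xl); rewrite -(aut_lt h) hx.
- by move=> c cm; apply/List.in_app_iff; left.
move=> g gP; rewrite -[g](mulgK h) -[(g * h)%g](mulVKg h).
apply: (HM _ _ _ (HV _ Hh)); apply: HM => //; apply: Hal => x xl.
rewrite !aut_mulE gP ?aut_invK//; apply/List.in_app_iff; right.
exact: (List.in_map (aut_fun h) (a :: l) x).
Qed.

End LimitAutomorphisms.

(** * Point stabilizers, orbits of pairs and realized triangles *)

Section LimitOrbits.
Variables (R : realType) (D : set R) (U : structure (lang D)).
Hypothesis hD : distance_value_set D.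
Hypothesis hU : fraisse_limit (@finite_ordered_metric_space R D) U.
Variable d : U -> U -> R.
Hypothesis hd : distance_of d.

Local Notation lt := (@interp _ U (Lt D)).

Lemma stabilizer_inj a b : D !=set0 ->
  (forall g : aut U, g a = a -> g b = b) -> a = b.
Proof.
move=> D0 ab; apply: contrapT => neq.
have [|g [ga gb]] := aut_moves hD hU hd (l := [:: a]) (b := b) D0.
  by case.
by apply/gb/ab/ga; left.
Qed.

(** Up to swapping [b] and [b'] the two pairs are ordered alike; then one automorphism matches the
    first points and another, fixing [b], the second ones. *)
Lemma isometric_pair_orbit a a' b b' : d a a' = d b b' ->
  exists g : aut U, (g a = b /\ g a' = b') \/ (g a = b' /\ g a' = b).
Proof.
move=> dab; have [aa'|aa'] := pselect (a = a').
  have bb' : b = b' by apply/(dist_eq0 hd); rewrite -dab aa' (distxx hd).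
  have [|||g [_ gab]] := aut_move_point hU hd (l := [::]) (x := a) (y := b) => //.
  by exists g; left; rewrite -aa' -bb'.
have bb' : b <> b'.
  by move=> bb'; apply/aa'/(dist_eq0 hd); rewrite dab bb' (distxx hd).
wlog ltab : b b' dab bb' / lt a a' <-> lt b b'.
  move=> W; have [|nlt] := pselect (lt a a' <-> lt b b'); first exact: W.
  have [|||g gP] := W b' b.
  - by rewrite dab (distC hd).
  - exact/nesym.
  - by rewrite [lt b' b](limit_ltN hU (nesym bb')); have := EM (lt a a'); tauto.
  by exists g; tauto.
have [|||g [_ gab]] := aut_move_point hU hd (l := [::]) (x := a) (y := b) => //.
have [|||h [hb hb']] :=
    aut_move_point hU hd (l := [:: b]) (x := g a') (y := b').
- by case=> //; rewrite -gab => /(bij_inj (aut_isomorphism g).1).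
- by case.
- move=> c [<-|//]; rewrite -{1 3}gab (aut_dist hd) (aut_lt g).
  by rewrite (distC hd) dab (distC hd).
exists (h * g)%g; left; rewrite !aut_mulE gab; split=> //.
by apply: hb; left.
Qed.

(** Three successive one-point extensions, each point above the earlier ones; the condition on the
    last is the triangle inequality. *)
Lemma triangle_realized x y z : triangle D x y z ->
  exists a b c, [/\ d a b = x, d a c = y & d b c = z].
Proof.
move=> [[Dx Dy Dz] /andP[xyz zxy]].
have [a _] := fraisse_limit_one_point_extension hD.1 hU (l := [::])
  (p := fun=> 0) (L := fun=> True) hd ltac:(done) ltac:(done) ltac:(done).
have xpos := hD.1 _ Dx; have ypos := hD.1 _ Dy; have zpos := hD.1 _ Dz.
have [||//|b bP] := fraisse_limit_one_point_extension hD.1 hU (l := [:: a])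
  (p := fun=> x) (L := fun=> True) hd.
- by [].
- by move=> u v [<-|//] [<-|//]; rewrite (distxx hd) subrr normr0 lexx /=; lra.
have [ba _] := bP a (or_introl erefl).
have ab : a <> b by move=> ab; move: ba; rewrite ab (distxx hd); lra.
pose p u := if pselect (u = a) is left _ then y else z.
have pa : p a = y by rewrite /p; case: pselect.
have pb : p b = z by rewrite /p; case: pselect => // ba'; case: ab.
have [||//|c cP] := fraisse_limit_one_point_extension hD.1 hU (l := [:: a; b])
  (p := p) (L := fun=> True) hd.
- by move=> u [<-|[<-|//]]; rewrite ?pa ?pb.
- move: xyz; rewrite ler_norml => xyz.
  by move=> u v [<-|[<-|//]] [<-|[<-|//]];
    rewrite ?pa ?pb ?(distxx hd) ?ba 1?[d a b](distC hd) ?ba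
            ?subrr ?normr0 ?ler_norml; lra.
exists a, b, c; rewrite [d a b](distC hd) ba; split=> //; rewrite (distC hd).
  by rewrite (cP a (or_introl erefl)).1.
by rewrite (cP b (or_intror (or_introl erefl))).1.
Qed.

End LimitOrbits.

(** * Transfer of point stabilizers along a topological isomorphism *)

Section OpenPreimage.
Variables (R : realType) (D E : set R).
Variables (U : structure (lang D)) (V : structure (lang E)).
Hypothesis hD : distance_value_set D.
Hypothesis hE : distance_value_set E.
Hypothesis hU : fraisse_limit (@finite_ordered_metric_space R D) U.
Hypothesis hV : fraisse_limit (@finite_ordered_metric_space R E) V.
Variables (dU : U -> U -> R) (dV : V -> V -> R).
Hypothesis hdU : distance_of dU.
Hypothesis hdV : distance_of dV.

(** The preimage under [psi] of the stabilizer of [a] is an open subgroup, and it is proper because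
    some automorphism moves [a]. *)
Lemma point_stabilizer_preimage (phi : aut U -> aut V) (psi : aut V -> aut U) :
    D !=set0 -> E !=set0 -> cancel phi psi -> {morph psi : x y / (x * y)%g} ->
    continuous psi ->
  forall a, exists b, forall h : aut V, psi h a = a -> h b = b.
Proof.
move=> D0 E0 phiK psiM psic a.
have psi1 : psi 1%g = 1%g.
  by apply: (mulgI (psi 1%g)); rewrite -psiM !mulg1.
have psiV h : psi (h^-1)%g = (psi h)^-1%g.
  by apply: (mulgI (psi h)); rewrite -psiM !mulgV.
apply: (open_subgroup_fixed_point hE hV hdV E0 (H := [set h | psi h a = a])).
- split=> /= [|g h ga ha|g ga]; first by rewrite psi1.
    by rewrite psiM aut_mulE ha.
  by rewrite psiV -{1}ga aut_invK.
- have /psic := @aut_nbhs _ U (psi 1%g) a.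
  by rewrite /nbhs /=; rewrite psi1.
have [//|g [_ ga]] := aut_moves hD hU hdU (l := [::]) (b := a) D0.
by exists (phi g); rewrite /= phiK.
Qed.

End OpenPreimage.

Section GroupIsomorphism.
Variables (R : realType) (D E : set R).
Variables (U : structure (lang D)) (V : structure (lang E)).
Hypothesis hD : distance_value_set D.
Hypothesis hE : distance_value_set E.
Hypothesis hU : fraisse_limit (@finite_ordered_metric_space R D) U.
Hypothesis hV : fraisse_limit (@finite_ordered_metric_space R E) V.
Variables (dU : U -> U -> R) (dV : V -> V -> R).
Hypothesis hdU : distance_of dU.
Hypothesis hdV : distance_of dV.
Hypotheses (D0 : D !=set0) (E0 : E !=set0).
Variables (phi : aut U -> aut V) (psi : aut V -> aut U).
Hypotheses (phiK : cancel phi psi) (psiK : cancel psi phi).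
Hypothesis phiM : {morph phi : x y / (x * y)%g}.
Hypotheses (phi_cont : continuous phi) (psi_cont : continuous psi).

(** Going to [V] and back gives a chain of stabilizers from [a] through [b] to [a']; an inclusion of
    point stabilizers forces [a = a'], so the chain collapses to equalities. *)
Lemma stabilizer_correspondence : exists beta : U -> V,
  forall a (g : aut U), g a = a <-> phi g (beta a) = beta a.
Proof.
have psiM : {morph psi : x y / (x * y)%g}.
  by move=> x y; rewrite -{1}(psiK x) -{1}(psiK y) -phiM phiK.
suff /choice[beta betaP] : forall a, exists b, forall g : aut U,
  g a = a <-> phi g b = b by exists beta.
move=> a.
have [b bP] := point_stabilizer_preimage hD hE hU hV hdU hdV D0 E0 phiK psiM
  psi_cont a.
have [a' aP] := point_stabilizer_preimage hE hD hV hU hdV hdU E0 D0 psiK phiM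
  phi_cont b.
have aa' : a = a'.
  apply: (stabilizer_inj hD hU hdU D0) => g ga.
  by apply/aP/bP; rewrite phiK.
exists b => g; split=> [ga|/aP]; first by apply: bP; rewrite phiK.
by rewrite -aa'.
Qed.

Variable beta : U -> V.
Hypothesis betaP : forall a (g : aut U), g a = a <-> phi g (beta a) = beta a.

(** If [h] fixes the left side, then [psi h] fixes [g a]; conjugating by [g] shows that [h] fixes
    the right side, and [stabilizer_inj] applies. *)
Lemma stabilizer_equivariant (g : aut U) a : beta (g a) = phi g (beta a).
Proof.
apply: (stabilizer_inj hE hV hdV E0) => h.
rewrite -{1 2}(psiK h) -betaP => hga.
have /betaP : (g^-1 * (psi h * g))%g a = a by rewrite !aut_mulE hga aut_invK.
rewrite !phiM psiK !aut_mulE => e.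
have phi1 : phi 1%g = 1%g.
  by apply: (mulgI (phi 1%g)); rewrite -phiM !mulg1.
by rewrite -[in RHS]e -[RHS]aut_mulE -phiM mulgV phi1.
Qed.

Lemma stabilizer_distance : exists f : R -> R,
  forall a a', dV (beta a) (beta a') = f (dU a a').
Proof.
suff /choice[f fP] : forall s, exists t, forall a a', dU a a' = s ->
    dV (beta a) (beta a') = t.
  by exists f => a a'; exact: fP.
move=> s; have [[a [a' <-]]|nex] := pselect (exists a a', dU a a' = s).
  exists (dV (beta a) (beta a')) => b b'.
  move=> /(isometric_pair_orbit hU hdU)[g [[<- <-]|[<- <-]]].
    by rewrite !stabilizer_equivariant (aut_dist hdV).
  by rewrite !stabilizer_equivariant (aut_dist hdV) (distC hdV).
by exists 0 => a a' aa'; case: nex; exists a, a'.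
Qed.

End GroupIsomorphism.

(** * From a topological isomorphism to an equivalence *)

Lemma trivial_aut (R : realType) (D : set R) (U : structure (lang D))
    (d : U -> U -> R) :
  distance_of d -> ~ (D !=set0) -> forall g h : aut U, g = h.
Proof.
move=> [_ dD _] D0 g h; apply: autP => x; apply: contrapT => /dD Dgh.
by apply: D0; exists (d (g x) (h x)).
Qed.

Lemma isomorphic_equivalent (R : realType) (D E : set R)
    (U : structure (lang D)) (V : structure (lang E)) :
    distance_value_set D -> distance_value_set E ->
    fraisse_limit (@finite_ordered_metric_space R D) U ->
    fraisse_limit (@finite_ordered_metric_space R E) V ->
  topological_group_isomorphic (aut U) (aut V) -> equivalent D E.
Proof.
move=> hD hE hU hV [phi [psi [phiK psiK phiM phic psic]]].
have [[dU hdU] _] := fraisse_limit_ordered hU.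
have [[dV hdV] _] := fraisse_limit_ordered hV.
have psiM : {morph psi : x y / (x * y)%g}.
  by move=> x y; rewrite -{1}(psiK x) -{1}(psiK y) -phiM phiK.
have point (S : set R) (W : structure (lang S)) :
    fraisse_limit (@finite_ordered_metric_space R S) W ->
    distance_value_set S -> exists _ : W, True.
  move=> hW hS; have [[dW hdW] _] := fraisse_limit_ordered hW.
  have [x _] := fraisse_limit_one_point_extension hS.1 hW (l := [::])
    (p := fun=> 0) (L := fun=> True) hdW ltac:(done) ltac:(done) ltac:(done).
  by exists x.
(* If [D] is empty then [aut U] is trivial, while a distance in [E] would give a nontrivial
   automorphism of [V]; so both sets are empty. *)
have [D0|D0] := pselect (D !=set0); last first.
  exists id; last by move=> x y z Dx; case: D0; exists x.
  split=> [x Dx|x y /set_mem Dx|s Es]; [by case: D0; exists x..|].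
  have [b _] := point _ _ hV hE.
  have [//|h [_]] := aut_moves hE hV hdV (l := [::]) (b := b) (ex_intro _ s Es).
  by case; rewrite -[h]psiK (trivial_aut hdU D0 (psi h) (psi 1%g)) psiK.
have [E0|E0] := pselect (E !=set0); last first.
  have [a _] := point _ _ hU hD.
  have [//|g [_]] := aut_moves hD hU hdU (l := [::]) (b := a) D0.
  by case; rewrite -[g]phiK (trivial_aut hdV E0 (phi g) (phi 1%g)) phiK.
have [beta betaP] := stabilizer_correspondence hD hE hU hV hdU hdV D0 E0
  phiK psiK phiM phic psic.
have [gamma gammaP] := stabilizer_correspondence hE hD hV hU hdV hdU E0 D0
  psiK phiK psiM psic phic.
have betaK : cancel beta gamma.
  move=> a; apply/esym/(stabilizer_inj hD hU hdU D0) => g /betaP/gammaP.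
  by rewrite phiK.
have gammaK : cancel gamma beta.
  move=> b; apply/esym/(stabilizer_inj hE hV hdV E0) => h /gammaP/betaP.
  by rewrite psiK.
have [f fP] := stabilizer_distance hE hU hV hdU hdV E0 psiK phiM betaP.
have [f' f'P] := stabilizer_distance hD hV hU hdV hdU D0 phiK psiM gammaP.
(* A single distance is realized as the side of an equilateral triangle. *)
have realD x : D x -> exists a b, dU a b = x.
  move=> Dx; have [|a [_ [b [_ ab _]]]] :=
    triangle_realized hD hU hdU (x := x) (y := x) (z := x).
    by split=> //; have := hD.1 _ Dx; rewrite subrr normr0; lra.
  by exists a, b.
have realE x : E x -> exists a b, dV a b = x.
  move=> Dx; have [|a [_ [b [_ ab _]]]] :=
    triangle_realized hE hV hdV (x := x) (y := x) (z := x).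
    by split=> //; have := hE.1 _ Dx; rewrite subrr normr0; lra.
  by exists a, b.
have fD x : D x -> E (f x) /\ f' (f x) = x.
  move=> Dx; have [a [b abx]] := realD _ Dx.
  rewrite -abx -fP -f'P !betaK; split=> //; apply: (dist_in hdV) => eab.
  have ab := can_inj betaK eab.
  by have := hD.1 _ Dx; rewrite -abx ab (distxx hdU) ltxx.
have f'E x : E x -> D (f' x) /\ f (f' x) = x.
  move=> Ex; have [a [b abx]] := realE _ Ex.
  rewrite -abx -f'P -fP !gammaK; split=> //; apply: (dist_in hdU) => eab.
  have ab := can_inj gammaK eab.
  by have := hE.1 _ Ex; rewrite -abx ab (distxx hdV) ltxx.
have triP (S : set R) (W : structure (lang S)) (dW : W -> W -> R) a b c :
    distance_of dW -> [/\ S (dW a b), S (dW a c) & S (dW b c)] ->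
    triangle S (dW a b) (dW a c) (dW b c).
  move=> hdW inS; split=> //; rewrite ler_norml.
  have := dist_triangle hdW a b c; have := dist_triangle hdW b a c.
  have := dist_triangle hdW a c b.
  by rewrite [dW b a](distC hdW) [dW c b](distC hdW); lra.
exists f; first split.
- by move=> x /fD[].
- by move=> x y /set_mem/fD[_ e] /set_mem/fD[_ e'] fxy; rewrite -e fxy e'.
- by move=> x /f'E[Dx <-]; exists (f' x).
move=> x y z Dx Dy Dz; split=> T.
  have [a [b [c [xE yE zE]]]] := triangle_realized hD hU hdU T.
  by rewrite -xE -yE -zE -!fP; apply: triP => //; rewrite !fP xE yE zE;
    split; apply fD.
have [a [b [c [xE yE zE]]]] := triangle_realized hE hV hdV T.
rewrite -(fD _ Dx).2 -(fD _ Dy).2 -(fD _ Dz).2 -xE -yE -zE -!f'P.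
apply: triP => //; rewrite !f'P xE yE zE.
by rewrite (fD _ Dx).2 (fD _ Dy).2 (fD _ Dz).2.
Qed.

(** * Abstract back-and-forth between countable sets *)

Section BackAndForth.
Variables (A B : Type) (C : A * B -> A * B -> Prop).
Let coherent (l : seq (A * B)) :=
  forall p q, List.In p l -> List.In q l -> C p q.
Hypotheses (countA : countable [set: A]) (countB : countable [set: B]).
Hypothesis forth : forall l, coherent l ->
  forall a, exists b, coherent ((a, b) :: l).
Hypothesis back : forall l, coherent l ->
  forall b, exists a, coherent ((a, b) :: l).

Lemma back_and_forth : exists G : A -> B -> Prop,
  [/\ forall a, exists b, G a b, forall b, exists a, G a b &
      forall a b a' b', G a b -> G a' b' -> C (a, b) (a', b')].
Proof.
have [i iinj] := countable_injP _ countA.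
have [j jinj] := countable_injP _ countB.
(* The list is kept when it is incoherent or when no point has code [n], so that [choice] yields a
   total step function. *)
have stepA n l : exists l', coherent l -> [/\ coherent l',
    forall p, List.In p l -> List.In p l' &
    forall a, i a = n -> exists b, List.In (a, b) l'].
  have [cl|ncl] := pselect (coherent l); last by exists l.
  have [[a an]|na] := pselect (exists a, i a = n); last first.
    by exists l => _; split=> // a an; case: na; exists a.
  have [b bP] := forth cl a; exists ((a, b) :: l) => _; split=> //.
    by move=> p; right.
  move=> a' a'n; exists b; left; congr (_, _).
  by apply: iinj; rewrite ?inE ?a'n.
have stepB n l : exists l', coherent l -> [/\ coherent l',
    forall p, List.In p l -> List.In p l' &
    forall b, j b = n -> exists a, List.In (a, b) l'].
  have [cl|ncl] := pselect (coherent l); last by exists l.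
  have [[b bn]|nb] := pselect (exists b, j b = n); last first.
    by exists l => _; split=> // b bn; case: nb; exists b.
  have [a aP] := back cl b; exists ((a, b) :: l) => _; split=> //.
    by move=> p; right.
  move=> b' b'n; exists a; left; congr (_, _).
  by apply: jinj; rewrite ?inE ?b'n.
have /choice[F FP] : forall nl : nat * seq (A * B), exists l',
    coherent nl.2 -> [/\ coherent l',
    forall p, List.In p nl.2 -> List.In p l',
    forall a, i a = nl.1 -> exists b, List.In (a, b) l' &
    forall b, j b = nl.1 -> exists a, List.In (a, b) l'].
  case=> n l /=; have [l1 l1P] := stepA n l; have [l2 l2P] := stepB n l1.
  exists l2 => /l1P[cl1 ll1 aP]; have [cl2 l12 bP] := l2P cl1.
  split=> // [p /ll1/l12//|a /aP[b ab]]; by exists b; exact: l12.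
pose fix s n := if n is n'.+1 then F (n', s n') else [::].
have sP n : coherent (s n) by elim: n => //= n /(FP (n, s n))[].
have sS m n p : (m <= n)%N -> List.In p (s m) -> List.In p (s n).
  move=> /subnK <-; elim: (n - m)%N => // k IHk pm.
  by have [_ + _ _] := FP (k + m, s (k + m))%N (sP _); apply; exact: IHk.
exists (fun a b => exists n, List.In (a, b) (s n)); split.
- move=> a; have [_ _ /(_ a erefl)[b ab] _] := FP (i a, s (i a)) (sP _).
  by exists b, (i a).+1.
- move=> b; have [_ _ _ /(_ b erefl)[a ab]] := FP (j b, s (j b)) (sP _).
  by exists a, (j b).+1.
- move=> a b a' b' [m am] [n an]; apply: (sP (maxn m n)).
    by apply: sS am; rewrite leq_maxl.
  by apply: sS an; rewrite leq_maxr.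
Qed.

End BackAndForth.

(** * Partial isomorphisms up to relabelling of distances *)

Section Coherence.
Variables (R : realType) (D E : set R).
Variables (U : structure (lang D)) (V : structure (lang E)).
Hypothesis hE : distance_value_set E.
Hypothesis hU : fraisse_limit (@finite_ordered_metric_space R D) U.
Hypothesis hV : fraisse_limit (@finite_ordered_metric_space R E) V.
Variables (dU : U -> U -> R) (dV : V -> V -> R).
Hypothesis hdU : distance_of dU.
Hypothesis hdV : distance_of dV.
Variable f : R -> R.
Hypothesis fE : forall x, D x -> E (f x).
Hypothesis fT : forall x y z, triangle D x y z -> triangle E (f x) (f y) (f z).

Local Notation ltU := (@interp _ U (Lt D)).
Local Notation ltV := (@interp _ V (Lt E)).

(** Distances are compared at distinct points only, since [f] relabels [D] and its value at [0] is
    arbitrary. *)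
Definition coherent_pairs (p q : U * V) : Prop :=
  [/\ p.1 = q.1 <-> p.2 = q.2, ltU p.1 q.1 <-> ltV p.2 q.2 &
      p.1 <> q.1 -> dV p.2 q.2 = f (dU p.1 q.1)].

(** Since [f] preserves triangles, the relabelled distances from [u] satisfy the condition for a
    one-point extension in [V]. *)
Lemma coherent_forth (l : seq (U * V)) :
    (forall p q, List.In p l -> List.In q l -> coherent_pairs p q) ->
  forall u, exists v, forall p q, List.In p ((u, v) :: l) ->
    List.In q ((u, v) :: l) -> coherent_pairs p q.
Proof.
move=> cl u; have [[v uv]|nu] := pselect (exists v, List.In (u, v) l).
  by exists v => p q [<-|pl] [<-|ql]; exact: cl.
have neq p : List.In p l -> u <> p.1.
  by case: p => u' v' pl /= uu'; apply: nu; exists v'; rewrite uu'.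
(* [k] inverts the finite partial map [l], with [u] as default value. *)
have /choice[k kP] : forall v, exists u', (exists u', List.In (u', v) l) ->
    List.In (u', v) l.
  move=> v; have [[u' u'v]|nv] := pselect (exists u', List.In (u', v) l).
    by exists u'.
  by exists u => /nv.
have inl v : List.In v (map snd l) -> List.In (k v, v) l.
  move=> /(proj1 (List.in_map_iff snd l v))[[u' v'] /= [<- u'l]].
  by apply: kP; exists u'.
have kE p : List.In p l -> k p.2 = p.1.
  case: p => u' v' pl /=.
  have pl' : List.In (k v', v') l by apply: kP; exists u'.
  by have [/= e _ _] := cl _ _ pl' pl; apply/e.
have Dk v : List.In v (map snd l) -> D (dU u (k v)).
  by move=> /inl /neq; exact: (dist_in hdU).
have [|||v vP] := fraisse_limit_one_point_extension hE.1 hV (l := map snd l)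
  (p := fun v => f (dU u (k v))) (L := fun v => ltU (k v) u) hdV.
- by move=> v /Dk; exact: fE.
- move=> v w vl wl; have [vw|vw] := pselect (v = w).
    rewrite vw subrr normr0 (distxx hdV) lexx /=.
    by have := hE.1 _ (fE (Dk _ wl)); lra.
  have [e _ dE] := cl _ _ (inl _ vl) (inl _ wl).
  have kvw : k v <> k w by move/e.
  rewrite dE//= ; suff [_] : triangle E (f (dU u (k v))) (f (dU u (k w)))
    (f (dU (k v) (k w))) by [].
  apply: fT; split; first by split; [exact: Dk|exact: Dk|exact: (dist_in hdU)].
  rewrite ler_norml.
  have := dist_triangle hdU u (k v) (k w); have := dist_triangle hdU u (k w) (k v).
  have := dist_triangle hdU (k v) u (k w).
  by rewrite [dU (k v) u](distC hdU) [dU (k w) (k v)](distC hdU); lra.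
- move=> v w vl wl vw kw; apply: (limit_lt_trans hU) kw.
  by have [_ /= ->] := cl _ _ (inl _ vl) (inl _ wl).
have vP' p : List.In p l -> [/\ dV v p.2 = f (dU u p.1), v <> p.2,
    ltU p.1 u <-> ltV p.2 v & ltU u p.1 <-> ltV v p.2].
  move=> pl; have pl2 := List.in_map snd l p pl.
  have [dvp ltp] := vP _ pl2; rewrite (kE _ pl) in dvp ltp.
  have vp : v <> p.2.
    move=> vp; have := hE.1 _ (fE (Dk _ pl2)).
    by rewrite (kE _ pl) -dvp vp (distxx hdV) ltxx.
  split=> //; first exact: iff_sym.
  by rewrite (limit_ltN hU (neq _ pl)) (limit_ltN hV vp) ltp.
exists v => p q [<-|pl] [<-|ql].
- by split=> //=; split=> [/(limit_ltxx hU)|/(limit_ltxx hV)].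
- have [dvq vq l1 l2] := vP' _ ql; have uq := neq _ ql.
  by split=> //=; split=> // ?; case: (uq).
- have [dvp vp l1 l2] := vP' _ pl; have up := neq _ pl.
  split=> //=; first by split=> // /esym.
  by rewrite (distC hdV) (distC hdU).
- exact: cl.
Qed.

End Coherence.

Lemma coherent_pairs_swap (R : realType) (D E : set R)
    (U : structure (lang D)) (V : structure (lang E))
    (dU : U -> U -> R) (dV : V -> V -> R) (f f' : R -> R) (p q : U * V) :
    distance_of dU -> (forall x, D x -> f' (f x) = x) ->
  coherent_pairs dU dV f p q ->
  coherent_pairs dV dU f' (p.2, p.1) (q.2, q.1).
Proof.
move=> hdU fK [e l dE]; split=> /=; [exact: iff_sym|exact: iff_sym|].
move=> pq; have pq1 : p.1 <> q.1 by move/e.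
by rewrite dE// fK//; exact: (dist_in hdU).
Qed.

(** An explicit inverse makes the data symmetric, so that the back step is the forth step for
    [f']. *)
Lemma equivalent_inverse (R : realType) (D E : set R) : equivalent D E ->
  exists f f' : R -> R,
    [/\ forall x, D x -> E (f x) /\ f' (f x) = x,
        forall x, E x -> D (f' x) /\ f (f' x) = x,
        forall x y z, triangle D x y z -> triangle E (f x) (f y) (f z) &
        forall x y z, triangle E x y z -> triangle D (f' x) (f' y) (f' z)].
Proof.
move=> [f [fE finj fsurj] fT].
have /choice[f' f'P] : forall y, exists x, E y -> D x /\ f x = y.
  move=> y; have [/fsurj[x Dx <-]|nE] := pselect (E y); first by exists x.
  by exists y => /nE.
have fK x : D x -> f' (f x) = x.
  move=> Dx; have [Dfx ffx] := f'P _ (fE _ Dx).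
  by apply: finj => //; exact: mem_set.
exists f, f'; split=> // [x Dx|x y z T|x y z T].
- by split; [exact: fE|exact: fK].
- by apply/fT => //; case: T => -[].
- have [[Ex Ey Ez] _] := T.
  have [Dx xE] := f'P _ Ex; have [Dy yE] := f'P _ Ey; have [Dz zE] := f'P _ Ez.
  by apply/fT => //; rewrite xE yE zE.
Qed.

(** [beta] need not preserve distances, but it relabels them uniformly, so conjugating the isometry
    [g] gives an isometry again. *)
Lemma conjugate_isomorphism (R : realType) (D E : set R)
    (U : structure (lang D)) (V : structure (lang E))
    (dU : U -> U -> R) (dV : V -> V -> R) (f : R -> R)
    (beta : U -> V) (gamma : V -> U) :
    distance_of dU -> distance_of dV -> cancel beta gamma -> cancel gamma beta ->
    (forall x y, coherent_pairs dU dV f (x, beta x) (y, beta y)) ->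
  forall g : aut U, isomorphism (fun v => beta (g (gamma v))).
Proof.
move=> hdU hdV betaK gammaK coh g; split.
  exists (fun v => beta ((g^-1)%g (gamma v))) => v; rewrite betaK.
    by rewrite aut_invK gammaK.
  by rewrite aut_invVK gammaK.
case=> [s|] x y.
  have [_ _ sP] := hdV; rewrite !sP; suff -> : dV (beta (g (gamma x)))
    (beta (g (gamma y))) = dV x y by [].
  have [<-|xy] := pselect (x = y); first by rewrite !(distxx hdV).
  have gxy : gamma x <> gamma y by move/(can_inj gammaK).
  have [_ _ /= ->] := coh (g (gamma x)) (g (gamma y)).
    have [_ _ /= /(_ gxy)] := coh (gamma x) (gamma y).
    by rewrite (aut_dist hdU) !gammaK.
  by move/(bij_inj (aut_isomorphism g).1).
have [_ /= <- _] := coh (g (gamma x)) (g (gamma y)).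
have [_ gP] := aut_isomorphism g.
by rewrite -gP; have [_ /= -> _] := coh (gamma x) (gamma y); rewrite !gammaK.
Qed.

Lemma equivalent_isomorphic (R : realType) (D E : set R)
    (U : structure (lang D)) (V : structure (lang E)) :
    distance_value_set D -> distance_value_set E ->
    fraisse_limit (@finite_ordered_metric_space R D) U ->
    fraisse_limit (@finite_ordered_metric_space R E) V ->
  equivalent D E -> topological_group_isomorphic (aut U) (aut V).
Proof.
move=> hD hE hU hV /equivalent_inverse[f [f' [fP f'P fT f'T]]].
have [[dU hdU] _] := fraisse_limit_ordered hU.
have [[dV hdV] _] := fraisse_limit_ordered hV.
have fE x : D x -> E (f x) by move/fP=> [].
have fK x : D x -> f' (f x) = x by move/fP=> [].
have f'E x : E x -> D (f' x) by move/f'P=> [].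
have f'K x : E x -> f (f' x) = x by move/f'P=> [].
have [countU _ _] := hU; have [countV _ _] := hV.
have [l cl v|G [Gl Gr Gc]] := back_and_forth countU countV
    (coherent_forth hE hU hV hdU hdV fE fT).
  pose sw (p : U * V) := (p.2, p.1).
  have swl p : List.In p (map sw l) -> List.In (p.2, p.1) l.
    by move=> /(proj1 (List.in_map_iff sw l p))[[a b] /= [<-]].
  have [|u uP] := coherent_forth hD hV hU hdV hdU f'E f'T (l := map sw l) _ v.
    move=> p q /swl pl /swl ql.
    have := coherent_pairs_swap hdU fK (cl _ _ pl ql).
    by case: p q {pl ql} => ? ? [].
  exists u => p q pl ql.
  have swin r : List.In r ((u, v) :: l) ->
      List.In (r.2, r.1) ((v, u) :: map sw l).
    by case=> [<-|rl]; [left|right; exact: (List.in_map sw l r rl)].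
  have := coherent_pairs_swap hdV f'K (uP _ _ (swin _ pl) (swin _ ql)).
  by case: p q {pl ql} => ? ? [].
have [beta betaP] := choice Gl; have [gamma gammaP] := choice Gr.
have betaK : cancel beta gamma.
  by move=> a; have [/= e _ _] := Gc _ _ _ _ (gammaP (beta a)) (betaP a); apply/e.
have gammaK : cancel gamma beta.
  by move=> b; have [/= e _ _] := Gc _ _ _ _ (betaP (gamma b)) (gammaP b); apply/e.
have coh x y : coherent_pairs dU dV f (x, beta x) (y, beta y).
  exact: Gc.
have coh' x y : coherent_pairs dV dU f' (x, gamma x) (y, gamma y).
  by have := coherent_pairs_swap hdU fK (coh (gamma x) (gamma y)); rewrite /= !gammaK.
pose phi g := Aut (conjugate_isomorphism hdU hdV betaK gammaK coh g).
pose psi h := Aut (conjugate_isomorphism hdV hdU gammaK betaK coh' h).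
exists phi, psi; split.
- by move=> g; apply: autP => x /=; rewrite !betaK.
- by move=> h; apply: autP => x /=; rewrite !gammaK.
- by move=> g h; apply: autP => x; rewrite aut_mulE /= betaK.
(* The value of the conjugate at [x] depends on [g] only through its value at [gamma x]. *)
- move=> g; apply/aut_cvgP => [|x]; first exact/fmap_filter/nbhs_filter.
  apply: filterS (aut_nbhs g (gamma x)).
  by move=> h /= ->.
- move=> g; apply/aut_cvgP => [|x]; first exact/fmap_filter/nbhs_filter.
  apply: filterS (aut_nbhs g (beta x)).
  by move=> h /= ->.
Qed.

Theorem theorem5p4 (R : realType) (Delta Lambda : set R)
    (hDelta : distance_value_set Delta) (hLambda : distance_value_set Lambda)
    (cDelta : countable Delta) (cLambda : countable Lambda)
    (U : structure (lang Delta)) (V : structure (lang Lambda))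
    (hU : fraisse_limit (@finite_ordered_metric_space R Delta) U)
    (hV : fraisse_limit (@finite_ordered_metric_space R Lambda) V) :
  topological_group_isomorphic (aut U) (aut V) <-> equivalent Delta Lambda.
Proof.
by split; [exact: isomorphic_equivalent|exact: equivalent_isomorphic].
Qed.
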